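(* If a solution of the three-body problem of the type described in the context has nonzero angular momentum, that is $c_1\neq 0$, and it also has negative total energy, that is $$c_2=-\frac{2m_1m_2}{h}-\frac{m_2^2}{2r}+m_2\,\dot Y\cdot\dot Y+\frac{m_1^2+2m_1m_2}{4m_2}\dot f^2<0 ,$$ where $Y=(r\cos\theta,r\sin\theta)$, then there is no collision. Moreover $$D=16c_1^2c_2m_2+(4m_1m_2+m_2^2)^2>0$$ and $$\frac{-4m_1m_2-m_2^2+\sqrt D}{4c_2}<r(t)<\frac{-4m_1m_2-m_2^2-\sqrt D}{4c_2}.$$
   Context: The gravitational constant is $1$ and the masses $m_1,m_2$ are positive. The solutions considered are the solutions of the three-body problem with masses $m_1,m_2,m_2$ (positions $x,y,z\in\mathbb{R}^3$) with $r(0)\neq0$ of the form $$x=(0,0,f),\quad y=\Big(r\cos\theta,\,r\sin\theta,\,-\tfrac{m_1}{2m_2}f\Big),\quad z=\Big(-r\cos\theta,\,-r\sin\theta,\,-\tfrac{m_1}{2m_2}f\Big),$$ where $r=\sqrt{y_1^2+y_2^2}$ and $$\ddot f=-\frac{2m_2kf}{h^3},\qquad \ddot r=\frac{c_1^2}{r^3}-\frac{m_2}{4r^2}-2(k-1)m_2\frac{r}{h^3},\qquad r^2\dot\theta=c_1,$$ with $k=\frac{m_1+2m_2}{2m_2}$, $h=\sqrt{r^2+k^2f^2}$ and $c_1=y_1(0)\dot y_2(0)-y_2(0)\dot y_1(0)$ (the angular momentum constant). The number $c_2$ is the conserved total energy (kinetic plus potential). There is a collision only when $r$ vanishes.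
   Formalization: D > 0 and the strict bounds on r(t) are stated only for f not identically zero; for planar solutions (f = 0) they fail (circular orbits have D = 0, elliptic ones attain both bounds). ''No collision'' is kept for all solutions. *)

(* Defs.v *)
From Stdlib Require Import Reals.
From Coquelicot Require Import Coquelicot.
Open Scope R_scope.

(* R^3 as (R * R) * R.  Coquelicot's norm on a product is
   sqrt (norm u ^ 2 + norm v ^ 2), so [norm] is the Euclidean norm here. *)
Definition V3 : NormedModule R_AbsRing :=
  prod_NormedModule R_AbsRing
    (prod_NormedModule R_AbsRing R_NormedModule R_NormedModule)
    R_NormedModule.

Definition vec3 (a b c : R) : V3 := ((a, b), c).
Definition coord1 (p : V3) : R := fst (fst p).
Definition coord2 (p : V3) : R := snd (fst p).

Definition dist3 (p q : V3) : R := norm (minus p q).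

Definition in_interval (a b : Rbar) (t : R) : Prop := Rbar_lt a t /\ Rbar_lt t b.

(* The velocity is quantified explicitly because [is_derive_n] speaks of the
   total function [Derive], which has a junk value where there is no
   derivative, and is only available for real-valued functions. *)
Definition second_derivative_on {V : NormedModule R_AbsRing}
    (a b : Rbar) (u acc : R -> V) : Prop :=
  exists v : R -> V, forall t, in_interval a b t ->
    is_derive u t (v t) /\ is_derive v t (acc t).

(* Acceleration of a body at [p] due to a mass [m] at [q], with G = 1. *)
Definition gravity (m : R) (p q : V3) : V3 :=
  scal (m / dist3 p q ^ 3) (minus q p).

(* Newton's equations make sense only where the bodies are at distinct points,
   so a motion lives on an open interval of such times; a collision is a limit
   at a finite end of that interval (see [collision_at]). *)
Definition three_body_motion (mx my mz : R) (a b : Rbar) (x y z : R -> V3) : Prop :=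
  (forall t, in_interval a b t -> x t <> y t /\ x t <> z t /\ y t <> z t) /\
  second_derivative_on a b x (fun t => plus (gravity my (x t) (y t)) (gravity mz (x t) (z t))) /\
  second_derivative_on a b y (fun t => plus (gravity mx (y t) (x t)) (gravity mz (y t) (z t))) /\
  second_derivative_on a b z (fun t => plus (gravity mx (z t) (x t)) (gravity my (z t) (y t))).

(* T ranges over the closure of (a, b); at an interior T the limit is the
   value of the distance at T. *)
Definition bodies_collide_at (a b : Rbar) (p q : R -> V3) (T : R) : Prop :=
  Rbar_le a T /\ Rbar_le T b /\
  filterlim (fun t => dist3 (p t) (q t)) (within (in_interval a b) (locally T)) (locally 0).

Definition collision_at (a b : Rbar) (x y z : R -> V3) (T : R) : Prop :=
  bodies_collide_at a b x y T \/ bodies_collide_at a b x z T \/ bodies_collide_at a b y z T.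

Definition mass_ratio (m1 m2 : R) : R := (m1 + 2 * m2) / (2 * m2).

Definition hyp (m1 m2 : R) (f r : R -> R) (t : R) : R :=
  sqrt (r t ^ 2 + mass_ratio m1 m2 ^ 2 * f t ^ 2).

Definition angular_momentum (y : R -> V3) : R :=
  coord1 (y 0) * Derive (fun t => coord2 (y t)) 0
  - coord2 (y 0) * Derive (fun t => coord1 (y t)) 0.

Record isosceles_motion (m1 m2 : R) (a b : Rbar) (x y z : R -> V3) (f r theta : R -> R) : Prop := {
  iso_three_body : three_body_motion m1 m2 m2 a b x y z;
  iso_x : forall t, in_interval a b t -> x t = vec3 0 0 (f t);
  iso_y : forall t, in_interval a b t ->
    y t = vec3 (r t * cos (theta t)) (r t * sin (theta t)) (- (m1 / (2 * m2)) * f t);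
  iso_z : forall t, in_interval a b t ->
    z t = vec3 (- (r t * cos (theta t))) (- (r t * sin (theta t))) (- (m1 / (2 * m2)) * f t);
  iso_r : forall t, in_interval a b t -> r t = sqrt (coord1 (y t) ^ 2 + coord2 (y t) ^ 2);
  iso_r0 : r 0 <> 0;
  iso_f_eq : second_derivative_on (V := R_NormedModule) a b f
    (fun t => - (2 * m2 * mass_ratio m1 m2 * f t) / hyp m1 m2 f r t ^ 3);
  iso_r_eq : second_derivative_on (V := R_NormedModule) a b r
    (fun t => angular_momentum y ^ 2 / r t ^ 3 - m2 / (4 * r t ^ 2)
              - 2 * (mass_ratio m1 m2 - 1) * m2 * (r t / hyp m1 m2 f r t ^ 3));
  iso_theta_eq : forall t, in_interval a b t ->
    ex_derive theta t /\ r t ^ 2 * Derive theta t = angular_momentum y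
}.

Definition energy (m1 m2 : R) (f r theta : R -> R) (t : R) : R :=
  - (2 * m1 * m2) / hyp m1 m2 f r t - m2 ^ 2 / (2 * r t)
  + m2 * (Derive (fun s => r s * cos (theta s)) t ^ 2
          + Derive (fun s => r s * sin (theta s)) t ^ 2)
  + (m1 ^ 2 + 2 * m1 * m2) / (4 * m2) * Derive f t ^ 2.

(* Main.v *)
(** Energy is conserved, and [h >= r], so the conserved energy [c2] dominates
    [m2 * c1^2 / r^2 - (4*m1*m2 + m2^2) / (2*r)].  Thus [r] satisfies
    [2*c2*r^2 + (4*m1*m2 + m2^2)*r - 2*m2*c1^2 >= 0], a quadratic inequality with
    negative leading coefficient and discriminant [D]; it keeps [r], hence every
    mutual distance, away from 0.  Equality at one time forces [f = f' = 0] there;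
    since [f] solves a linear equation [f'' = - q f] with [q] bounded, it would
    then vanish identically. *)

Require Import Defs.
From Stdlib Require Import Reals Lra Psatz.
From Coquelicot Require Import Coquelicot.
Open Scope R_scope.

(** * Intervals with extended real endpoints *)

Lemma in_interval_between (a b : Rbar) (s t u : R) :
  in_interval a b s -> in_interval a b t ->
  Rmin s t <= u <= Rmax s t -> in_interval a b u.
Proof.
unfold in_interval, Rmin, Rmax.
destruct a as [a| |], b as [b| |]; simpl; intros [] [];
  destruct (Rle_dec s t); intros []; split; trivial; lra.
Qed.

(** Moving from [T] a small fraction of the way towards [s] stays in the interval by convexity. This
    makes limits at a finite endpoint non-vacuous. *)
Lemma in_interval_near_closure (a b : Rbar) (s T : R) (eps : posreal) :
  in_interval a b s -> Rbar_le a T -> Rbar_le T b ->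
  exists t, in_interval a b t /\ Rabs (t - T) < eps.
Proof.
intros Hs HaT HTb.
assert (He := cond_pos eps).
destruct (Req_dec T s) as [->|HTs].
  exists s; split; trivial.
  rewrite Rminus_diag, Rabs_R0; exact He.
assert (Hd : 0 < Rabs (s - T)) by (apply Rabs_pos_lt; lra).
(* The bound 1/2 keeps the point strictly between [T] and [s]; the other bound makes the
   displacement at most [eps / 2]. *)
set (w := Rmin (1 / 2) (eps / (2 * Rabs (s - T)))).
assert (Hw : 0 < w).
{ apply Rmin_glb_lt; [lra|]. apply Rdiv_lt_0_compat; lra. }
assert (Hw1 : w <= 1 / 2) by apply Rmin_l.
assert (Hw2 : w * Rabs (s - T) <= eps / 2).
{ apply Rle_trans with (eps / (2 * Rabs (s - T)) * Rabs (s - T)).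
  - apply Rmult_le_compat_r; [lra|apply Rmin_r].
  - right; field; lra. }
exists (T + w * (s - T)); split.
- revert Hs HaT HTb; unfold in_interval.
  destruct (Rlt_or_le s T);
  destruct a as [a| |], b as [b| |]; simpl; intros [] Ha Hb; split; trivial;
    nra.
- replace (T + w * (s - T) - T) with (w * (s - T)) by ring.
  rewrite Rabs_mult, (Rabs_pos_eq w); lra.
Qed.

(** * Constancy and uniqueness for differential equations *)

Lemma is_derive_0_constant (a b : Rbar) (g : R -> R) :
  (forall t, in_interval a b t -> is_derive g t 0) ->
  forall s t, in_interval a b s -> in_interval a b t -> g s = g t.
Proof.
intros Hg s t Hs Ht.
destruct (MVT_gen g s t (fun _ => 0)) as [c [_ Hc]].
- intros u Hu; apply Hg, (in_interval_between a b s t); trivial; lra.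
- intros u Hu; apply derivable_continuous_pt, ex_derive_Reals_0.
  exists 0; apply Hg, (in_interval_between a b s t); trivial.
- lra.
Qed.

(** Gronwall's argument in both time directions: with the integrating factor [exp (s * u)], where
    [s] is [- K] after [t0] and [K] before it, the product does not increase as [u] moves away from
    [t0], where it is 0. *)
Lemma gronwall_nonpos (a b : Rbar) (g dg : R -> R) (K t0 t : R) :
  (forall u, in_interval a b u -> is_derive g u (dg u)) ->
  (forall u, in_interval a b u -> Rabs (dg u) <= K * g u) ->
  in_interval a b t0 -> in_interval a b t -> g t0 = 0 -> g t <= 0.
Proof.
intros Hg HK Ht0 Ht Hg0.
set (s := if Rle_dec t0 t then - K else K).
destruct (MVT_gen (fun u => g u * exp (s * u)) t0 t
           (fun u => (dg u + s * g u) * exp (s * u))) as [c [Hc Heq]].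
- intros u Hu.
  assert (Hu' : in_interval a b u)
    by (apply (in_interval_between a b t0 t); trivial; lra).
  auto_derive.
  + exists (dg u); apply Hg; trivial.
  + rewrite (is_derive_unique (fun w : R => g w) _ _ (Hg u Hu')); ring.
- intros u Hu.
  assert (Hu' : in_interval a b u)
    by (apply (in_interval_between a b t0 t); trivial).
  apply derivable_continuous_pt, ex_derive_Reals_0.
  auto_derive; exists (dg u); apply Hg; trivial.
- assert (Hc' := HK c (in_interval_between a b t0 t c Ht0 Ht Hc)).
  apply Rabs_le_between in Hc'.
  rewrite Hg0 in Heq.
  assert (Hs : (dg c + s * g c) * (t - t0) <= 0).
  { unfold s; destruct (Rle_dec t0 t); nra. }
  assert (Ec := exp_pos (s * c)).
  assert (Et := exp_pos (s * t)).
  assert (g t * exp (s * t) <= 0) by nra.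
  nra.
Qed.

(** Gronwall applies to [f ^ 2 + v ^ 2]: its derivative is [2 * (1 - q) * f * v], and
    [2 * |f * v| <= f ^ 2 + v ^ 2]. *)
Lemma linear_second_order_unique (a b : Rbar) (f v q : R -> R) (M t0 : R) :
  (forall t, in_interval a b t -> is_derive f t (v t)) ->
  (forall t, in_interval a b t -> is_derive v t (- q t * f t)) ->
  (forall t, in_interval a b t -> Rabs (q t) <= M) ->
  in_interval a b t0 -> f t0 = 0 -> v t0 = 0 ->
  forall t, in_interval a b t -> f t = 0.
Proof.
intros Hf Hv Hq Ht0 Hf0 Hv0 t Ht.
assert (H : f t ^ 2 + v t ^ 2 <= 0).
{ apply (gronwall_nonpos a b (fun u => f u ^ 2 + v u ^ 2)
           (fun u => 2 * (1 - q u) * (f u * v u)) (1 + M) t0); trivial.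
  - intros u Hu; auto_derive.
    + split; [exists (v u); auto|split; [exists (- q u * f u); auto|trivial]].
    + rewrite (is_derive_unique (fun w : R => f w) _ _ (Hf u Hu)),
        (is_derive_unique (fun w : R => v w) _ _ (Hv u Hu)).
      ring.
  - intros u Hu.
    rewrite !Rabs_mult, (Rabs_pos_eq 2) by lra.
    assert (Hq' : Rabs (1 - q u) <= 1 + M).
    { specialize (Hq u Hu); revert Hq; unfold Rabs; do 2 destruct Rcase_abs; lra. }
    assert (P : 2 * (Rabs (f u) * Rabs (v u)) <= f u ^ 2 + v u ^ 2).
    { rewrite <- (pow2_abs (f u)), <- (pow2_abs (v u)).
      assert (S := pow2_ge_0 (Rabs (f u) - Rabs (v u))); lra. }
    assert (0 <= Rabs (f u) * Rabs (v u))
      by (apply Rmult_le_pos; apply Rabs_pos).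
    assert (0 <= Rabs (1 - q u)) by apply Rabs_pos.
    replace (2 * Rabs (1 - q u) * (Rabs (f u) * Rabs (v u)))
      with (Rabs (1 - q u) * (2 * (Rabs (f u) * Rabs (v u)))) by ring.
    apply Rmult_le_compat; lra.
  - rewrite Hf0, Hv0; ring. }
nra.
Qed.

(** * Distances, limits and a quadratic inequality *)

Lemma dist3_vec3 (a b c a' b' c' : R) :
  dist3 (vec3 a b c) (vec3 a' b' c')
  = sqrt ((a - a') ^ 2 + (b - b') ^ 2 + (c - c') ^ 2).
Proof.
(* The nested product norm unfolds to a square root inside a square; squaring removes the inner
   root. *)
change (dist3 (vec3 a b c) (vec3 a' b' c'))
  with (sqrt (sqrt (Rabs (a - a') ^ 2 + Rabs (b - b') ^ 2) ^ 2 + Rabs (c - c') ^ 2)).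
rewrite pow2_sqrt, !pow2_abs; trivial.
apply Rplus_le_le_0_compat; apply pow2_ge_0.
Qed.

Lemma bounded_below_no_limit_0 (a b : Rbar) (d : R -> R) (s T rho : R) :
  in_interval a b s -> Rbar_le a T -> Rbar_le T b -> 0 < rho ->
  (forall t, in_interval a b t -> rho <= d t) ->
  ~ filterlim d (within (in_interval a b) (locally T)) (locally 0).
Proof.
intros Hs HaT HTb Hrho Hd Hlim.
destruct (Hlim (fun u => u < rho)) as [eps He].
- exists (mkposreal rho Hrho); intros u Hu.
  change (Rabs (u - 0) < rho) in Hu.
  apply Rabs_lt_between in Hu; lra.
- destruct (in_interval_near_closure a b s T eps Hs HaT HTb) as [t [Ht Htd]].
  specialize (He t Htd Ht); specialize (Hd t Ht); simpl in He; lra.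
Qed.

(** Completing the square gives [(2 * A * X + B) ^ 2 - D = 4 * A * (A * X ^ 2 + B * X + C) < 0]. As
    [A] is negative, the root with [+ sqrt D] is the smaller one. *)
Lemma quadratic_pos_between_roots (A B C X D : R) :
  A < 0 -> 0 < A * X ^ 2 + B * X + C -> D = B ^ 2 - 4 * A * C ->
  0 < D /\ (- B + sqrt D) / (2 * A) < X < (- B - sqrt D) / (2 * A).
Proof.
intros HA HX HD.
assert (HS : (2 * A * X + B) ^ 2 < D) by (subst D; nra).
assert (HD0 : 0 < D) by (assert (S := pow2_ge_0 (2 * A * X + B)); lra).
assert (HB : Rabs (2 * A * X + B) < sqrt D).
{ rewrite <- sqrt_Rsqr_abs; apply sqrt_lt_1_alt; rewrite Rsqr_pow2.
  split; [apply pow2_ge_0|lra]. }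
apply Rabs_lt_between in HB.
split; [trivial|split].
- apply Rmult_lt_reg_l with (- (2 * A)); [lra|].
  replace (- (2 * A) * ((- B + sqrt D) / (2 * A))) with (B - sqrt D) by (field; lra).
  lra.
- apply Rmult_lt_reg_l with (- (2 * A)); [lra|].
  replace (- (2 * A) * ((- B - sqrt D) / (2 * A))) with (B + sqrt D) by (field; lra).
  lra.
Qed.

(** * Conservation of energy and the quadratic inequality *)

(** The energy with the angle eliminated through [r ^ 2 * theta' = c], and with velocities as
    explicit functions, so that the equations of motion for [f] and [r] suffice to differentiate
    it. *)
Definition polar_energy (m1 m2 c : R) (f r vf vr : R -> R) (t : R) : R :=
  - (2 * m1 * m2) / hyp m1 m2 f r t - m2 ^ 2 / (2 * r t)
  + m2 * (vr t ^ 2 + c ^ 2 / r t ^ 2)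
  + (m1 ^ 2 + 2 * m1 * m2) / (4 * m2) * vf t ^ 2.

Lemma energy_polar (m1 m2 c : R) (f r theta vf vr : R -> R) (t : R) :
  is_derive f t (vf t) -> is_derive r t (vr t) -> ex_derive theta t ->
  r t ^ 2 * Derive theta t = c -> r t <> 0 ->
  energy m1 m2 f r theta t = polar_energy m1 m2 c f r vf vr t.
Proof.
intros Hf Hr Hth Hc Hr0.
unfold energy, polar_energy.
rewrite (is_derive_unique _ _ _ Hf).
rewrite (is_derive_unique (fun s : R => r s * cos (theta s)) t
  (vr t * cos (theta t) - r t * (Derive theta t * sin (theta t)))).
2:{ auto_derive.
    - split; [exists (vr t); trivial|split; trivial].
    - rewrite (is_derive_unique (fun w : R => r w) _ _ Hr).
      change (Derive (fun x => theta x) t) with (Derive theta t); ring. }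
rewrite (is_derive_unique (fun s : R => r s * sin (theta s)) t
  (vr t * sin (theta t) + r t * (Derive theta t * cos (theta t)))).
2:{ auto_derive.
    - split; [exists (vr t); trivial|split; trivial].
    - rewrite (is_derive_unique (fun w : R => r w) _ _ Hr).
      change (Derive (fun x => theta x) t) with (Derive theta t); ring. }
replace (c ^ 2 / r t ^ 2) with (r t ^ 2 * Derive theta t ^ 2)
  by (subst c; field; trivial).
assert (Hcs := sin2_cos2 (theta t)); unfold Rsqr in Hcs.
do 2 f_equal.
(* A factor sin^2 + cos^2 = 1 is inserted to turn the goal into a polynomial identity. *)
replace (vr t ^ 2 + r t ^ 2 * Derive theta t ^ 2) with
  ((vr t ^ 2 + r t ^ 2 * Derive theta t ^ 2)
   * (sin (theta t) * sin (theta t) + cos (theta t) * cos (theta t)))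
  by (rewrite Hcs; ring).
ring.
Qed.

Lemma hyp_ge_r (m1 m2 : R) (f r : R -> R) (t : R) :
  0 <= r t -> r t <= hyp m1 m2 f r t.
Proof.
intros Hr; unfold hyp.
rewrite <- (sqrt_pow2 (r t)) at 1 by trivial.
apply sqrt_le_1_alt.
assert (H := pow2_ge_0 (mass_ratio m1 m2 * f t)); lra.
Qed.

(** With [h' = (r * r' + k ^ 2 * f * f') / h], the terms in [1 / h ^ 3] cancel because
    [2 * m2 * k = m1 + 2 * m2] and [2 * m2 * (k - 1) = m1]; the terms in [1 / r ^ 2] and [1 / r ^ 3]
    cancel separately. *)
Lemma is_derive_polar_energy (m1 m2 c : R) (f r vf vr : R -> R) (t : R) :
  0 < m2 -> 0 < r t ->
  is_derive f t (vf t) -> is_derive r t (vr t) ->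
  is_derive vf t (- (2 * m2 * mass_ratio m1 m2 * f t) / hyp m1 m2 f r t ^ 3) ->
  is_derive vr t (c ^ 2 / r t ^ 3 - m2 / (4 * r t ^ 2)
              - 2 * (mass_ratio m1 m2 - 1) * m2 * (r t / hyp m1 m2 f r t ^ 3)) ->
  is_derive (polar_energy m1 m2 c f r vf vr) t 0.
Proof.
intros Hm Hr Df Dr Dvf Dvr.
assert (Hh := hyp_ge_r m1 m2 f r t (Rlt_le _ _ Hr)).
assert (Hrad : 0 < r t ^ 2 + mass_ratio m1 m2 ^ 2 * f t ^ 2).
{ assert (H := pow2_ge_0 (mass_ratio m1 m2 * f t)).
  assert (0 < r t ^ 2) by (apply pow_lt; trivial); lra. }
assert (Dh : is_derive (hyp m1 m2 f r) t
  ((r t * vr t + mass_ratio m1 m2 ^ 2 * f t * vf t) / hyp m1 m2 f r t)).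
{ unfold hyp at 1; auto_derive.
  - repeat split; [exists (vr t)|exists (vf t)|]; trivial.
  - rewrite (is_derive_unique (fun w : R => f w) _ _ Df),
      (is_derive_unique (fun w : R => r w) _ _ Dr).
    unfold hyp in Hh |- *.
    simpl in Hh |- *.
    field; lra. }
unfold polar_energy.
set (h := hyp m1 m2 f r) in *.
auto_derive.
- repeat split; try (eexists; eassumption); nra.
- rewrite (is_derive_unique (fun w : R => r w) _ _ Dr),
    (is_derive_unique (fun w : R => vf w) _ _ Dvf),
    (is_derive_unique (fun w : R => vr w) _ _ Dvr),
    (is_derive_unique (fun w : R => h w) _ _ Dh).
  unfold mass_ratio; field; repeat split; lra.
Qed.

(** [P] is [2 * r ^ 2] times a sum of nonnegative terms: the potential gap from [h >= r] and two
    kinetic terms. If [P] vanishes, so does each term; then [h = r] gives [f = 0] since [k > 0]. *)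
Lemma polar_energy_quadratic (m1 m2 c E : R) (f r vf vr : R -> R) (t : R) :
  0 < m1 -> 0 < m2 -> 0 < r t ->
  polar_energy m1 m2 c f r vf vr t = E ->
  let P := 2 * E * r t ^ 2 + (4 * m1 * m2 + m2 ^ 2) * r t + - (2 * m2 * c ^ 2) in
  0 <= P /\ (P = 0 -> f t = 0 /\ vf t = 0).
Proof.
intros Hm1 Hm2 Hr HE P.
assert (Hh := hyp_ge_r m1 m2 f r t (Rlt_le _ _ Hr)).
assert (HP : P = 2 * r t ^ 2 * (2 * m1 * m2 * (/ r t - / hyp m1 m2 f r t)
   + m2 * vr t ^ 2 + (m1 ^ 2 + 2 * m1 * m2) / (4 * m2) * vf t ^ 2)).
{ unfold P; rewrite <- HE; unfold polar_energy; field; lra. }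
assert (Hinv : / hyp m1 m2 f r t <= / r t) by (apply Rinv_le_contravar; trivial).
assert (T1 : 0 <= 2 * m1 * m2 * (/ r t - / hyp m1 m2 f r t))
  by (apply Rmult_le_pos; nra).
assert (T2 : 0 <= m2 * vr t ^ 2) by (apply Rmult_le_pos; nra).
assert (HA : 0 < (m1 ^ 2 + 2 * m1 * m2) / (4 * m2))
  by (apply Rdiv_lt_0_compat; nra).
assert (T3 : 0 <= (m1 ^ 2 + 2 * m1 * m2) / (4 * m2) * vf t ^ 2)
  by (apply Rmult_le_pos; nra).
assert (Hr2 : 0 < 2 * r t ^ 2) by nra.
split.
- rewrite HP; apply Rmult_le_pos; lra.
- intros H0; rewrite HP in H0.
  apply Rmult_integral in H0; destruct H0 as [H0|H0]; [lra|].
  assert (Z1 : 2 * m1 * m2 * (/ r t - / hyp m1 m2 f r t) = 0) by lra.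
  assert (Z3 : (m1 ^ 2 + 2 * m1 * m2) / (4 * m2) * vf t ^ 2 = 0) by lra.
  split.
  + assert (Hi : / r t = / hyp m1 m2 f r t).
    { apply Rmult_integral in Z1; destruct Z1; nra. }
    apply (f_equal Rinv) in Hi; rewrite !Rinv_inv in Hi.
    assert (Hsq : r t ^ 2 = r t ^ 2 + mass_ratio m1 m2 ^ 2 * f t ^ 2).
    { rewrite Hi at 1; unfold hyp; apply pow2_sqrt.
      assert (H := pow2_ge_0 (mass_ratio m1 m2 * f t)).
      assert (H' := pow2_ge_0 (r t)); lra. }
    assert (Hk : 0 < mass_ratio m1 m2)
      by (unfold mass_ratio; apply Rdiv_lt_0_compat; lra).
    assert (Hkf : (mass_ratio m1 m2 * f t) ^ 2 = 0) by (rewrite Rpow_mult_distr; lra).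
    destruct (Req_dec (f t) 0) as [|Hf]; trivial.
    exfalso; apply (pow_nonzero (mass_ratio m1 m2 * f t) 2); trivial.
    apply Rmult_integral_contrapositive; split; lra.
  + apply Rmult_integral in Z3; destruct Z3; nra.
Qed.

(** * Geometry of the isosceles configuration *)

(** At [r t = 0] the two equal masses would coincide, which the domain of the motion excludes. *)
Lemma isosceles_r_pos (m1 m2 : R) (a b : Rbar) (x y z : R -> V3)
    (f r theta : R -> R) (t : R) :
  isosceles_motion m1 m2 a b x y z f r theta -> in_interval a b t -> 0 < r t.
Proof.
intros H Ht.
assert (Hr : 0 <= r t) by (rewrite (iso_r _ _ _ _ _ _ _ _ _ _ H t Ht); apply sqrt_pos).
destruct Hr as [|Hr]; trivial.
exfalso.
destruct (iso_three_body _ _ _ _ _ _ _ _ _ _ H) as [Hd _].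
destruct (Hd t Ht) as [_ [_ Hyz]].
apply Hyz.
rewrite (iso_y _ _ _ _ _ _ _ _ _ _ H t Ht), (iso_z _ _ _ _ _ _ _ _ _ _ H t Ht), <- Hr.
f_equal; ring.
Qed.

Lemma isosceles_dist_ge_r (m1 m2 : R) (a b : Rbar) (x y z : R -> V3)
    (f r theta : R -> R) (t : R) :
  isosceles_motion m1 m2 a b x y z f r theta -> in_interval a b t ->
  r t <= dist3 (x t) (y t) /\ r t <= dist3 (x t) (z t) /\ r t <= dist3 (y t) (z t).
Proof.
intros H Ht.
assert (Hr := isosceles_r_pos _ _ _ _ _ _ _ _ _ _ t H Ht).
rewrite (iso_x _ _ _ _ _ _ _ _ _ _ H t Ht), (iso_y _ _ _ _ _ _ _ _ _ _ H t Ht),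
  (iso_z _ _ _ _ _ _ _ _ _ _ H t Ht), !dist3_vec3.
assert (Hp : (r t * cos (theta t)) ^ 2 + (r t * sin (theta t)) ^ 2 = r t ^ 2).
{ assert (Hcs := sin2_cos2 (theta t)); unfold Rsqr in Hcs.
  transitivity (r t ^ 2 * (sin (theta t) * sin (theta t) + cos (theta t) * cos (theta t)));
    [ring|rewrite Hcs; ring]. }
assert (Hz := pow2_ge_0 (f t - - (m1 / (2 * m2)) * f t)).
assert (Hr2 := pow2_ge_0 (r t)).
(* Occurrences 1, 4 and 7 are the left-hand sides of the three inequalities. *)
rewrite <- (sqrt_pow2 (r t)) at 1 4 7 by lra.
repeat split; apply sqrt_le_1_alt; nra.
Qed.

Theorem theorem2p3 :
  forall (m1 m2 : R) (a b : Rbar) (x y z : R -> V3) (f r theta : R -> R) (c1 c2 D : R),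
    0 < m1 -> 0 < m2 ->
    in_interval a b 0 ->
    isosceles_motion m1 m2 a b x y z f r theta ->
    c1 = angular_momentum y ->
    c2 = energy m1 m2 f r theta 0 ->
    D = 16 * c1 ^ 2 * c2 * m2 + (4 * m1 * m2 + m2 ^ 2) ^ 2 ->
    c1 <> 0 ->
    c2 < 0 ->
    (forall T : R, ~ collision_at a b x y z T) /\
    ((exists t, in_interval a b t /\ f t <> 0) ->
      0 < D /\
      forall t, in_interval a b t ->
        (- (4 * m1 * m2) - m2 ^ 2 + sqrt D) / (4 * c2) < r t /\
        r t < (- (4 * m1 * m2) - m2 ^ 2 - sqrt D) / (4 * c2)).
Proof.
intros m1 m2 a b x y z f r theta c1 c2 D Hm1 Hm2 H0 Hiso Hc1 Hc2 HD Hc10 Hc20.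
assert (Hr : forall t, in_interval a b t -> 0 < r t)
  by (intros t Ht; eapply isosceles_r_pos; eassumption).
destruct (iso_f_eq _ _ _ _ _ _ _ _ _ _ Hiso) as [vf Hvf].
destruct (iso_r_eq _ _ _ _ _ _ _ _ _ _ Hiso) as [vr Hvr].
rewrite <- Hc1 in Hvr.
(* The polar form is constant along the motion, so it need be compared with [energy] only at time
   0. *)
assert (HE : forall t, in_interval a b t -> polar_energy m1 m2 c1 f r vf vr t = c2).
{ intros t Ht.
  transitivity (polar_energy m1 m2 c1 f r vf vr 0).
  - apply (is_derive_0_constant a b); trivial.
    intros u Hu; destruct (Hvf u Hu), (Hvr u Hu).
    apply is_derive_polar_energy; auto.
  - rewrite Hc2; symmetry.
    destruct (iso_theta_eq _ _ _ _ _ _ _ _ _ _ Hiso 0 H0) as [Hth Hth'].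
    rewrite <- Hc1 in Hth'.
    apply energy_polar; trivial; [apply Hvf|apply Hvr|]; trivial.
    apply Rgt_not_eq, Hr; trivial. }
assert (HP := fun t Ht =>
  polar_energy_quadratic m1 m2 c1 c2 f r vf vr t Hm1 Hm2 (Hr t Ht) (HE t Ht)).
cbv zeta in HP.
assert (HB : 0 < 4 * m1 * m2 + m2 ^ 2) by nra.
set (B := 4 * m1 * m2 + m2 ^ 2) in *.
(* As [c2 < 0], dropping the square term of the quadratic inequality leaves
   [B * r >= 2 * m2 * c1 ^ 2]. This uniform bound excludes collisions and later bounds the
   coefficient of the equation for [f]. *)
set (rho := 2 * m2 * c1 ^ 2 / B).
assert (Hc1sq : 0 < c1 ^ 2) by (apply pow2_gt_0; trivial).
assert (Hrho : 0 < rho) by (apply Rdiv_lt_0_compat; nra).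
assert (Hrr : forall t, in_interval a b t -> rho <= r t).
{ intros t Ht; destruct (HP t Ht) as [HPt _].
  apply Rmult_le_reg_l with B; trivial.
  replace (B * rho) with (2 * m2 * c1 ^ 2) by (unfold rho; field; lra).
  assert (0 <= r t ^ 2) by apply pow2_ge_0; nra. }
split.
- intros T HT.
  assert (Hdist := fun t Ht => isosceles_dist_ge_r _ _ _ _ _ _ _ _ _ _ t Hiso Ht).
  destruct HT as [[Ha [Hb Hl]]|[[Ha [Hb Hl]]|[Ha [Hb Hl]]]];
    refine (bounded_below_no_limit_0 a b _ 0 T rho H0 Ha Hb Hrho _ Hl);
    intros t Ht; specialize (Hrr t Ht); destruct (Hdist t Ht) as [? [? ?]]; lra.
(* If [f] vanished identically, the quadratic would be [2 * m2 * r ^ 2 * r' ^ 2], with equality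
   wherever [r' = 0]; a time with [f] nonzero rules this out. *)
- intros [s [Hs Hfs]].
  assert (Hstrict : forall t, in_interval a b t ->
    0 < 2 * c2 * r t ^ 2 + B * r t + - (2 * m2 * c1 ^ 2)).
  { intros t Ht; destruct (HP t Ht) as [[|Heq] Hdeg]; trivial.
    destruct (Hdeg (eq_sym Heq)) as [Hft Hvft].
    exfalso; apply Hfs.
    assert (Hk : 0 < mass_ratio m1 m2)
      by (unfold mass_ratio; apply Rdiv_lt_0_compat; lra).
    (* Here [q = 2 * m2 * k / h ^ 3], bounded through [rho <= r <= h]. *)
    apply (linear_second_order_unique a b f vf
      (fun u => 2 * m2 * mass_ratio m1 m2 / hyp m1 m2 f r u ^ 3)
      (2 * m2 * mass_ratio m1 m2 / rho ^ 3) t); trivial.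
    - intros u Hu; apply (Hvf u Hu).
    - intros u Hu; destruct (Hvf u Hu) as [_ Hvf'].
      replace (- _ * f u) with (- (2 * m2 * mass_ratio m1 m2 * f u) / hyp m1 m2 f r u ^ 3);
        trivial.
      unfold Rdiv; ring.
    - intros u Hu.
      assert (Hh := hyp_ge_r m1 m2 f r u (Rlt_le _ _ (Hr u Hu))).
      specialize (Hrr u Hu).
      assert (Hnum : 0 < 2 * m2 * mass_ratio m1 m2) by nra.
      assert (0 < rho ^ 3) by (apply pow_lt; trivial).
      rewrite Rabs_pos_eq.
      + apply Rmult_le_compat_l; [lra|].
        apply Rinv_le_contravar; trivial.
        apply pow_incr; lra.
      + apply Rlt_le, Rdiv_lt_0_compat; trivial.
        apply pow_lt; lra. }
  (* The discriminant [B ^ 2 - 4 * (2 * c2) * (- (2 * m2 * c1 ^ 2))] is exactly [D]. *)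
  assert (Hroots := fun t Ht => quadratic_pos_between_roots (2 * c2) B
    (- (2 * m2 * c1 ^ 2)) (r t) D ltac:(lra) (Hstrict t Ht) ltac:(rewrite HD; ring)).
  split; [apply (Hroots 0 H0)|].
  intros t Ht; destruct (Hroots t Ht) as [_ Hrt].
  replace (- (4 * m1 * m2) - m2 ^ 2) with (- B) by (unfold B; ring).
  replace (4 * c2) with (2 * (2 * c2)) by ring.
  exact Hrt.
Qed.
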